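(* For every integer $n \geq 11$ there is no permutation $\pi \in \mathcal{S}_n$ such that both $\pi$ and $\theta(\pi)$ avoid the pattern $123$; that is, $t_n(123) = 0$.
   Context: $\mathcal{S}_n$ is the symmetric group on $[n]=\{1,\dots,n\}$, permutations written in one-line notation $\pi=\pi_1\pi_2\cdots\pi_n$ with $\pi_i=\pi(i)$. A permutation $\pi$ contains a pattern $\tau\in\mathcal{S}_k$ if there are indices $i_1<\dots<i_k$ with $\pi_{i_r}<\pi_{i_s}$ iff $\tau_r<\tau_s$; otherwise $\pi$ avoids $\tau$. The standard cycle notation of $\pi$ writes each cycle (including fixed points as 1-cycles) with its largest element first, and orders the cycles by increasing largest element. The fundamental bijection $\theta:\mathcal{S}_n\to\mathcal{S}_n$ sends $\pi$ to the permutation whose one-line notation is obtained by erasing the parentheses in the standard cycle notation of $\pi$ (e.g. $41352987=(3)(5,2,1,4)(8)(9,7)$ gives $\theta(41352987)=35214897$). $t_n(\sigma)$ is the number of $\pi\in\mathcal{S}_n$ such that both $\pi$ and $\theta(\pi)$ avoid $\sigma$. *)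

(* Defs.v *)
From mathcomp Require Import all_boot all_fingroup.
Set Implicit Arguments.
Unset Strict Implicit.
Unset Printing Implicit Defensive.

(* The set [n] = {1, .., n} is represented by 'I_n = {0, .., n.-1}, i.e. both  *)
(* positions and values are shifted down by one; the one-line notation of     *)
(* pi : 'S_n is the sequence of the values pi i for i increasing.             *)

Definition contains (n k : nat) (pi : 'S_n) (tau : 'S_k) : bool :=
  [exists f : {ffun 'I_k -> 'I_n},
     [forall r : 'I_k, forall s : 'I_k, (r < s) ==> (f r < f s)] &&
     [forall r : 'I_k, forall s : 'I_k,
        (pi (f r) < pi (f s)) == (tau r < tau s)]].

Definition avoids (n k : nat) (pi : 'S_n) (tau : 'S_k) : bool :=
  ~~ contains pi tau.

Definition pattern123 : 'S_3 := 1%g.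

Definition is_cycle_max (n : nat) (pi : 'S_n) (x : 'I_n) : bool :=
  [forall y in porbit pi x, y <= x].

(* [:: x; pi x; pi (pi x); ...], each element of the cycle of x listed once.  *)
Definition cycle_from (n : nat) (pi : 'S_n) (x : 'I_n) : seq 'I_n :=
  traject pi x #|porbit pi x|.

(* enum 'I_n is increasing, so the cycles are sorted by largest element.      *)
Definition standard_cycles (n : nat) (pi : 'S_n) : seq (seq 'I_n) :=
  [seq cycle_from pi x | x <- enum 'I_n & is_cycle_max pi x].

Definition theta_word (n : nat) (pi : 'S_n) : seq 'I_n :=
  flatten (standard_cycles pi).

Lemma mem_cycle_from n (pi : 'S_n) x y :
  (y \in cycle_from pi x) = (y \in porbit pi x).
Proof. by rewrite porbit_traject. Qed.

Lemma theta_word_uniq n (pi : 'S_n) : uniq (theta_word pi).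
Proof.
rewrite /theta_word /standard_cycles.
have us : uniq [seq x <- enum 'I_n | is_cycle_max pi x].
  exact/filter_uniq/enum_uniq.
have ms : all (is_cycle_max pi) [seq x <- enum 'I_n | is_cycle_max pi x].
  exact: filter_all.
elim: [seq x <- _ | _] us ms => //= x s IHs /andP[xNs us] /andP[mx ms].
rewrite cat_uniq uniq_traject_porbit IHs // andbT /=.
apply/hasPn => y /flatten_mapP[z zs]; rewrite mem_cycle_from => yz.
apply: contra xNs => /=; rewrite mem_cycle_from => yx.
have exz : porbit pi x = porbit pi z.
  by move: yx yz; rewrite -!eq_porbit_mem => /eqP-> /eqP->.
have lezx : z <= x.
  by move/forall_inP: mx; apply; rewrite exz porbit_id.
have lexz : x <= z.
  by move/forall_inP: (allP ms z zs); apply; rewrite -exz porbit_id.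
suff -> : x = z by [].
by apply/val_inj/eqP; rewrite eqn_leq lexz lezx.
Qed.

Lemma mem_theta_word n (pi : 'S_n) y : y \in theta_word pi.
Proof.
pose x := [arg max_(x > y in porbit pi y) (x : nat)].
have [xy mx] : x \in porbit pi y /\ (forall z, z \in porbit pi y -> z <= x).
  by rewrite /x; case: arg_maxnP => [|z zy mz]; [exact: porbit_id | split].
have exy : porbit pi x = porbit pi y by apply/eqP; rewrite eq_porbit_mem.
apply/flatten_mapP; exists x.
  rewrite mem_filter mem_enum andbT.
  by apply/forall_inP => z; rewrite exy => /mx.
by rewrite mem_cycle_from exy porbit_id.
Qed.

Lemma size_theta_word n (pi : 'S_n) : size (theta_word pi) = n.
Proof.
rewrite -(card_uniqP (theta_word_uniq pi)) -[RHS]card_ord.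
by apply: eq_card => y; rewrite mem_theta_word.
Qed.

(* The default value of nth is irrelevant: size (theta_word pi) = n.          *)
Definition theta_fun (n : nat) (pi : 'S_n) (i : 'I_n) : 'I_n :=
  nth i (theta_word pi) i.

Lemma theta_fun_inj n (pi : 'S_n) : injective (theta_fun pi).
Proof.
move=> i j; rewrite /theta_fun => /eqP.
rewrite (set_nth_default i) ?size_theta_word //.
by rewrite nth_uniq ?size_theta_word ?theta_word_uniq // => /eqP/val_inj.
Qed.

Definition theta (n : nat) (pi : 'S_n) : 'S_n := perm (@theta_fun_inj n pi).

Definition t (n k : nat) (sigma : 'S_k) : nat :=
  #|[set pi : 'S_n | avoids pi sigma && avoids (theta pi) sigma]|.

(* Main.v *)
(** If [theta pi] avoids 123 then [pi] has at most two cycles, because the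
    cycle maxima occur in increasing order in the word of [theta pi].  Moreover
    this word is the union of two decreasing subsequences, its left-to-right
    minima and the other letters.  Classify the letters [x] which are not the
    last one of their cycle, so that [pi x] follows [x] in the word, by the
    subsequences to which [x] and [pi x] belong.  Within one of the four
    classes both [x] and [pi x] decrease along the word, so three letters of
    one class are an occurrence of 123 in [pi].  Hence [n - 2 <= 4 * 2]. *)
Require Import Defs.
From mathcomp Require Import all_boot all_fingroup.

Lemma avoids_pattern123 n (pi : 'S_n) (x y z : 'I_n) :
  avoids pi pattern123 -> x < y < z -> ~~ (pi x < pi y < pi z).
Proof.
move=> av /andP[xy yz]; apply: contra av => /andP[pxy pyz].
have [xz pxz] := (ltn_trans xy yz, ltn_trans pxy pyz).
apply/existsP; exists [ffun i : 'I_3 => tnth [tuple x; y; z] i].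
have ltF (a b : 'I_n) : a < b -> (b < a) = false by move=> ab; rewrite ltnNge ltnW.
apply/andP; split; apply/forallP => -[[|[|[]]] // ?];
  apply/forallP => -[[|[|[]]] // ?]; rewrite !ffunE !(tnth_nth x) ?perm1 //=;
  by rewrite ?ltnn ?pxy ?pyz ?pxz ?(ltF _ _ pxy) ?(ltF _ _ pyz) ?(ltF _ _ pxz).
Qed.

Lemma sorted_filter_ord n (P : pred 'I_n) :
  sorted ltn (map val [seq x <- enum 'I_n | P x]).
Proof.
rewrite sorted_map; apply: sorted_filter.
  by move=> y x z; apply: ltn_trans.
by rewrite -sorted_map val_enum_ord iota_ltn_sorted.
Qed.

Lemma ord_set_gt2 n (A : {set 'I_n}) :
  2 < #|A| -> exists x y z, [/\ x \in A, y \in A, z \in A & x < y < z].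
Proof.
rewrite cardE; have := sorted_filter_ord n (mem A).
rewrite enumT -[X in map _ X]/(enum A).
have: {subset enum A <= A} by move=> x; rewrite mem_enum.
case: (enum A) => [|x [|y [|z s]]] //= sA /and3P[xy yz _] _.
by exists x, y, z; rewrite !sA ?xy ?inE ?eqxx ?orbT.
Qed.

Section ThetaWord.

Variables (n : nat) (pi : 'S_n).
Implicit Types x y z : 'I_n.

Let pos x := index x (theta_word pi).

(** Each cycle is a contiguous block of the word, and blocks come by increasing maximum. This cut
    around the block of [y] serves to compare and compute positions. *)
Lemma theta_word_split y : is_cycle_max pi y ->
  exists s1 s2, theta_word pi = s1 ++ cycle_from pi y ++ s2 /\
    forall x, is_cycle_max pi x -> x < y -> x \in s1.
Proof.
move=> my; rewrite /theta_word /standard_cycles.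
have := sorted_filter_ord n (is_cycle_max pi).
have mem_l x : is_cycle_max pi x ->
    x \in [seq x <- enum 'I_n | is_cycle_max pi x].
  by rewrite mem_filter mem_enum andbT.
have yl := mem_l y my; case/splitPr: yl mem_l => l1 l2 mem_l.
rewrite map_cat /= (sorted_pairwise ltn_trans) pairwise_cat /= => /and3P[_ _].
case/andP=> y_lt _.
exists (flatten (map (cycle_from pi) l1)), (flatten (map (cycle_from pi) l2)).
rewrite map_cat flatten_cat /=; split=> // x mx ltxy.
apply/flatten_mapP; exists x; last by rewrite mem_cycle_from porbit_id.
have := mem_l x mx; rewrite mem_cat inE => /or3P[//|/eqP exy|xl2].
  by rewrite exy ltnn in ltxy.
have := allP y_lt (val x); rewrite map_f // => /(_ isT) /= ltyx.
by have := ltn_trans ltxy ltyx; rewrite ltnn.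
Qed.

Lemma pos_cycle_max x y : is_cycle_max pi x -> is_cycle_max pi y ->
  x < y -> pos x < pos y.
Proof.
move=> mx my ltxy; have [s1 [s2 [def_s in_s1]]] := theta_word_split y my.
have := theta_word_uniq pi; rewrite /pos def_s cat_uniq => /and3P[_ s1N _].
have ys1 : y \notin s1.
  by apply: contra s1N => ys1; apply/hasP; exists y; rewrite // mem_cat
    mem_cycle_from porbit_id.
rewrite !index_cat (in_s1 x) // (negPf ys1).
by apply: leq_trans (leq_addr _ _); rewrite index_mem in_s1.
Qed.

(** A block lists the iterates of [pi] from its cycle maximum, and only its last letter is sent back
    to that maximum. *)
Lemma pos_succ x : ~~ is_cycle_max pi (pi x) -> pos (pi x) = (pos x).+1.
Proof.
move=> Npx; have /flatten_mapP[y] := mem_theta_word pi x.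
rewrite mem_filter => /andP[my _] /trajectP[i lti def_x].
have def_px : pi x = iter i.+1 pi y by rewrite def_x.
(* If [i.+1] were the cycle length, [pi x] would be the maximum [y] again. *)
have lti1 : i.+1 < #|porbit pi y|.
  rewrite ltn_neqAle lti andbT; apply: contra Npx => /eqP ei.
  by rewrite def_px ei iter_porbit.
have [s1 [s2 [def_s _]]] := theta_word_split y my.
have pos_iter j : j < #|porbit pi y| -> pos (iter j pi y) = size s1 + j.
  move=> ltj; have <- : nth y (theta_word pi) (size s1 + j) = iter j pi y.
    rewrite def_s nth_cat ltnNge leq_addr /= addKn nth_cat size_traject ltj.
    by rewrite nth_traject.
  rewrite /pos index_uniq ?theta_word_uniq // def_s !size_cat ltn_add2l.
  by rewrite size_traject ltn_addr.
by rewrite def_px def_x !pos_iter // addnS.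
Qed.

Hypothesis theta_av : avoids (theta pi) pattern123.

(** [pos] inverts [theta pi], so avoidance can be stated on letters instead of positions. *)
Lemma pos_avoids x y z : x < y < z -> ~~ (pos x < pos y < pos z).
Proof.
have pos_lt w : pos w < n.
  by rewrite -[n](size_theta_word pi) index_mem mem_theta_word.
have thetaK w : theta pi (Ordinal (pos_lt w)) = w.
  by rewrite permE /theta_fun nth_index ?mem_theta_word.
move=> xyz; apply/negP => pxyz.
have /negP[] := avoids_pattern123 _ _ (Ordinal (pos_lt x)) (Ordinal (pos_lt y))
  (Ordinal (pos_lt z)) theta_av pxyz.
by rewrite !thetaK.
Qed.

Lemma card_cycle_max : #|[set x | is_cycle_max pi x]| <= 2.
Proof.
rewrite leqNgt; apply/negP => /ord_set_gt2[x [y [z []]]]; rewrite !inE.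
move=> mx my mz xyz; have /negP[] := pos_avoids x y z xyz.
by case/andP: xyz => xy yz; rewrite !pos_cycle_max.
Qed.

Let lr_min x := [forall y : 'I_n, (y < x) ==> (pos x <= pos y)].

Lemma lr_min_decreasing x y : lr_min x = lr_min y -> x < y -> pos y < pos x.
Proof.
move=> eq_m ltxy; rewrite ltnNge leq_eqVlt; apply/norP; split.
  apply/eqP => /(congr1 (nth x (theta_word pi))).
  by rewrite !nth_index ?mem_theta_word // => exy; rewrite exy ltnn in ltxy.
(* Since [x] is smaller and earlier, [y] is no left-to-right minimum; hence neither is [x], and a
   smaller letter [w] before [x] completes a 123. *)
apply/negP => ltp; have Nmy : ~~ lr_min y.
  by apply/forallPn; exists x; rewrite ltxy -ltnNge.
move: Nmy; rewrite -eq_m => /forallPn[w]; rewrite negb_imply -ltnNge.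
case/andP=> ltwx ltpw.
have /negP[] : ~~ (pos w < pos x < pos y) by rewrite pos_avoids ?ltwx.
by rewrite ltpw.
Qed.

(** The order is reversed twice: [y] precedes [x] in the word, so [pi y], right after [y], precedes
    [pi x], and the class of the images is decreasing too. *)
Lemma image_increasing x y :
  lr_min x = lr_min y -> lr_min (pi x) = lr_min (pi y) ->
  ~~ is_cycle_max pi (pi x) -> ~~ is_cycle_max pi (pi y) ->
  x < y -> pi x < pi y.
Proof.
move=> mxy mpxy Nx Ny ltxy; have := lr_min_decreasing x y mxy ltxy.
rewrite -ltnS -(pos_succ x) // -(pos_succ y) // => ltp; rewrite ltnNge leq_eqVlt.
apply/norP; split.
  by apply/eqP => /val_inj/perm_inj eyx; rewrite eyx ltnn in ltxy.
apply/negP => /(lr_min_decreasing _ _ (esym mpxy)) /(ltn_trans ltp).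
by rewrite ltnn.
Qed.

Lemma theta_avoids_bound : avoids pi pattern123 -> n <= 10.
Proof.
move=> pi_av; pose E := [set x | ~~ is_cycle_max pi (pi x)].
have cardE : n <= #|E| + 2.
  (* [pi] maps the complement of [E] injectively into the at most two cycle maxima. *)
  rewrite -[X in X <= _]card_ord -(cardsC E) leq_add2l -(card_imset _ (@perm_inj _ pi)).
  apply: leq_trans card_cycle_max; apply/subset_leq_card/subsetP => y.
  by case/imsetP => x; rewrite !inE negbK => mx ->.
apply: leq_trans cardE _; rewrite (leq_add2r 2 _ 8).
pose kind x := (lr_min x, lr_min (pi x)).
have -> : #|E| = \sum_(c : bool * bool) #|[set x in E | kind x == c]|.
  rewrite -sum1_card (partition_big kind predT) //=.
  by apply: eq_bigr => c _; rewrite -sum1_card; apply: eq_bigl => x; rewrite !inE.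
(* Two letters for each of the four kinds. *)
have -> : 8 = \sum_(c : bool * bool) 2.
  by rewrite sum_nat_const card_prod card_bool.
apply: leq_sum => c _; rewrite leqNgt; apply/negP => /ord_set_gt2[x [y [z []]]].
rewrite !inE => /andP[Nx /eqP kx] /andP[Ny /eqP ky] /andP[Nz /eqP kz] xyz.
have /negP[] := avoids_pattern123 _ _ x y z pi_av xyz.
have [mxy mpxy] : kind x = kind y by rewrite kx ky.
have [myz mpyz] : kind y = kind z by rewrite ky kz.
by case/andP: xyz => xy yz; rewrite !image_increasing.
Qed.

End ThetaWord.

Theorem theorem3p1 (n : nat) (hn : 11 <= n) :
  (~ exists pi : 'S_n, avoids pi pattern123 /\ avoids (theta pi) pattern123)
  /\ t n pattern123 = 0.
Proof.
have none (pi : 'S_n) :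
    avoids pi pattern123 -> avoids (theta pi) pattern123 -> False.
  by move=> av /theta_avoids_bound/(_ av); rewrite leqNgt hn.
split=> [[pi [av avt]]|]; first exact: none av avt.
by apply: eq_card0 => pi; rewrite inE; apply/negP => /andP[]; apply: none.
Qed.
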